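(* Let $\mu$ be a (finite) non-negative Borel measure on the unit circle $\mathbb{T}=\{z\in\mathbb{C}:|z|=1\}$ such that its Fourier coefficients $\widehat\mu(n)=\int_{\mathbb{T}} z^n\,\mu(dz)$ $(n\in\mathbb{Z})$ vanish at infinity, that is, $\widehat\mu(n)\to 0$ as $|n|\to\infty$. Then the projective orbit $O_{\rm pr}(M,f)=\{\lambda M^nf:\ n\in\mathbb{N}_0,\ \lambda\in\mathbb{C}\}$ is weakly sequentially closed for any $f\in L_2(\mu)$, where the multiplication operator $Mf(z)=zf(z)$ acts on $L_2(\mu)$. In particular, $M$ is not weakly sequentially supercyclic.
   Context: $\mathbb{N}_0=\{0,1,2,\dots\}$; $L_2(\mu)$ is the complex Hilbert space. A subset $A$ of a topological space $X$ is sequentially closed if the limit of every sequence of elements of $A$ that converges in $X$ belongs to $A$. The sequential closure $[A]_{\rm s}$ of $A$ is the intersection of all sequentially closed sets containing $A$; $A$ is sequentially dense in $X$ if $[A]_{\rm s}=X$. ''Weakly sequentially closed/dense'' refers to the weak topology of the Banach space. A bounded linear operator $T$ on a complex Banach space $\mathcal{B}$ is weakly sequentially supercyclic if there is $x\in\mathcal{B}$ such that $\{\lambda T^nx:n\in\mathbb{N}_0,\lambda\in\mathbb{C}\}$ is weakly sequentially dense in $\mathcal{B}$.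
   Formalization: The final claim that M is not weakly sequentially supercyclic is stated for nonzero μ only: for μ = 0 the space L_2(μ) is {0} and M is trivially supercyclic. Closedness of the projective orbits is stated for every μ. *)

(* Defs.v *)
From HB Require Import structures.
From mathcomp Require Import all_boot all_order all_algebra.
From mathcomp Require Import all_classical all_reals all_analysis measurable_realfun.
Set Implicit Arguments.
Unset Strict Implicit.
Unset Printing Implicit Defensive.
Import Order.TTheory GRing.Theory Num.Theory.
Import numFieldNormedType.Exports.
From mathcomp Require Import complex.
Import ComplexField.Normc.
Local Open Scope classical_set_scope.
Local Open Scope ring_scope.
Local Open Scope complex_scope.
Local Open Scope quotient_scope.

(* MathComp-Analysis puts the norm topology of a numFieldType on [R[i]^o] only;
   transport it to [R[i]]. *)
HB.instance Definition _ (R : realType) := NormedModule.copy R[i] (R[i]^o).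

Section SequentialTopology.
Context (X : topologicalType).
Implicit Type A : set X.

Definition seq_closed A :=
  forall (u : nat -> X) (l : X), (forall n, A (u n)) -> u @ \oo --> l -> A l.

Definition seq_closure A : set X := smallest seq_closed A.

Definition seq_dense A := seq_closure A = setT.

End SequentialTopology.

(* [weak_space V] is [V] with the coarsest topology that makes every
   norm-continuous linear functional continuous. *)
Section WeakTopology.
Context (K : numFieldType) (V : normedModType K).

Definition weak_space : Type :=
  sup_topology (fun phi : {f : {linear V -> K^o} | continuous f} =>
    Topological.on (initial_topology (sval phi : V -> K^o))).

HB.instance Definition _ := Topological.on weak_space.

Lemma cvg_weak_space (u : nat -> V) (l : V) :
  (u @ \oo --> (l : weak_space)) <->
  (forall f : {linear V -> K^o}, continuous f -> f \o u @ \oo --> f l).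
Proof.
rewrite cvg_sup; split=> [ul f cf|ul [f cf]].
  move=> B /(@initial_continuous V K^o f l).
  exact: (ul (exist _ f cf)).
move=> B; rewrite nbhsE /= => -[_ [[C oC <-] Cfl] CB].
apply: filterS (CB) _; apply: (ul f cf).
exact: open_nbhs_nbhs.
Qed.

Definition weakly_seq_closed (A : set V) := @seq_closed weak_space A.

Definition weakly_seq_dense (A : set V) := @seq_dense weak_space A.

End WeakTopology.

(* Completeness of [V] and boundedness of [T] play no role in these definitions;
   [L2] below is instantiated as a normed module and [mulz_continuous] gives the
   boundedness of the multiplication operator. *)
Section Orbits.
Context (K : numFieldType) (V : normedModType K).

Definition proj_orbit (T : V -> V) (x : V) : set V :=
  [set y | exists (n : nat) (a : K), y = a *: iter n T x].

Definition weakly_seq_supercyclic (T : {linear V -> V}) :=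
  exists x : V, weakly_seq_dense (proj_orbit T x).

End Orbits.

Section ComplexFunctions.
Context d (T : measurableType d) (R : realType).
Variable mu : {measure set T -> \bar R}.
Implicit Types f g : T -> R[i].

(* Componentwise measurability, i.e. Borel measurability into the plane. *)
Definition cmeasurable f :=
  measurable_fun setT (fun x => Re (f x)) /\
  measurable_fun setT (fun x => Im (f x)).

Definition cintegral f : R[i] :=
  (\int[mu]_x Re (f x)) +i* (\int[mu]_x Im (f x)).

Definition square_integrable f :=
  cmeasurable f /\ finite_norm mu 2%:E (@normc R \o f).

Definition norm2 f : R := fine ('N[mu]_2%:E[EFin \o (@normc R \o f)]).

Lemma cmeasurable_normc f : cmeasurable f -> measurable_fun setT (@normc R \o f).
Proof.
move=> [mr mi].
have -> : @normc R \o f = Num.sqrt \o (fun x => Re (f x) ^+ 2 + Im (f x) ^+ 2).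
  by apply/funext => x /=; case: (f x).
apply: measurableT_comp.
  by apply: continuous_measurable_fun; exact: sqrt_continuous.
by apply: measurable_funD; apply: measurable_funX.
Qed.

Lemma cmeasurable0 : cmeasurable (0 : T -> R[i]).
Proof. by split; exact: measurable_cst. Qed.

Lemma ReD (x y : R[i]) : Re (x + y) = Re x + Re y.
Proof. by case: x; case: y. Qed.

Lemma ImD (x y : R[i]) : Im (x + y) = Im x + Im y.
Proof. by case: x; case: y. Qed.

Lemma ReM (x y : R[i]) : Re (x * y) = Re x * Re y - Im x * Im y.
Proof. by case: x; case: y. Qed.

Lemma ImM (x y : R[i]) : Im (x * y) = Re x * Im y + Im x * Re y.
Proof. by case: x; case: y. Qed.

Lemma cmeasurableD f g : cmeasurable f -> cmeasurable g -> cmeasurable (f + g).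
Proof.
move=> [fr fi] [gr gi]; split.
  under eq_fun do rewrite ReD; exact: measurable_funD.
under eq_fun do rewrite ImD; exact: measurable_funD.
Qed.

Lemma cmeasurableM f g :
  cmeasurable f -> cmeasurable g -> cmeasurable (fun x => f x * g x).
Proof.
move=> [fr fi] [gr gi]; split.
  under eq_fun do rewrite ReM.
  by apply: measurable_funB; exact: measurable_funM.
under eq_fun do rewrite ImM.
by apply: measurable_funD; exact: measurable_funM.
Qed.

Lemma cmeasurableZ a f : cmeasurable f -> cmeasurable (a *: f).
Proof.
by move=> mf; apply: cmeasurableM => //; split; exact: measurable_cst.
Qed.

Lemma normc_ge0 (z : R[i]) : 0 <= normc z.
Proof. by case: z => a b; exact: sqrtr_ge0. Qed.

Lemma le_Lnorm2 (u v : T -> R) :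
  measurable_fun setT u -> measurable_fun setT v ->
  (forall x, `|u x| <= `|v x|) ->
  ('N[mu]_2%:E[EFin \o u] <= 'N[mu]_2%:E[EFin \o v])%E.
Proof.
move=> mu_ mv uv; rewrite unlock /Lnorm.
apply: gt0_ler_poweR => //; rewrite ?in_itv/= ?leey ?andbT ?invr_ge0//.
- by apply: integral_ge0 => x _; rewrite lee_fin powR_ge0.
- by apply: integral_ge0 => x _; rewrite lee_fin powR_ge0.
have mp (w : T -> R) : measurable_fun setT w ->
    measurable_fun setT (fun x => (`|w x| `^ 2)%:E).
  move=> mw; apply/measurable_EFinP.
  by apply/(@measurableT_comp _ _ _ _ _ _ (@powR R ^~ 2)) => //;
    exact/measurableT_comp.
apply: ge0_le_integral => //.
- exact: mp.
- exact: mp.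
by move=> x _ /=; rewrite lee_fin ge0_ler_powR.
Qed.


Lemma square_integrable0 : square_integrable (0 : T -> R[i]).
Proof.
split; first exact: cmeasurable0.
rewrite /finite_norm (@eq_Lnorm _ _ _ _ _ _ (cst 0%E)) ?Lnorm0 ?eqe//.
by move=> x; congr EFin; exact: normc0.
Qed.

Lemma Lnorm2D f g : cmeasurable f -> cmeasurable g ->
  ('N[mu]_2%:E[EFin \o (@normc R \o (f + g)%R)] <=
   'N[mu]_2%:E[EFin \o (@normc R \o f)] +
   'N[mu]_2%:E[EFin \o (@normc R \o g)])%E.
Proof.
move=> mf mg; have mnf := cmeasurable_normc mf; have mng := cmeasurable_normc mg.
apply: le_trans (minkowski_EFin mu mnf mng _); last by rewrite ler1n.
apply: le_Lnorm2; [|exact: measurable_funD|].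
  by apply: cmeasurable_normc; exact: cmeasurableD.
by move=> x /=; rewrite !ger0_norm ?addr_ge0 ?normc_ge0 ?le_normcD.
Qed.

Lemma square_integrableD f g :
  square_integrable f -> square_integrable g -> square_integrable (f + g).
Proof.
move=> [mf lf] [mg lg]; split; first exact: cmeasurableD.
by apply: (le_lt_trans (Lnorm2D mf mg)); rewrite lte_add_pinfty.
Qed.

Lemma Lnorm2Z a f : square_integrable f ->
  ('N[mu]_2%:E[EFin \o (@normc R \o (a *: f)%R)] =
   (normc a)%:E * 'N[mu]_2%:E[EFin \o (@normc R \o f)])%E.
Proof.
move=> [mf lf].
have lnf : @normc R \o f \in Lfun mu 2%:E.
  by apply/andP; split; rewrite inE//=; exact: cmeasurable_normc.
have /= := LnormZ (Lfun_Sub (lee1n 2) lnf) (normc a).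
rewrite ger0_norm ?normc_ge0// => <-; apply: eq_Lnorm => x /=.
by rewrite normcM.
Qed.

Lemma square_integrableZ a f :
  square_integrable f -> square_integrable (a *: f).
Proof.
move=> sf; split; first by apply: cmeasurableZ; case: sf.
rewrite /finite_norm Lnorm2Z// lte_mul_pinfty ?lee_fin ?normc_ge0//.
by case: sf.
Qed.

End ComplexFunctions.

Section SquareIntegrable.
Context d (T : measurableType d) (R : realType).
Variable mu : {measure set T -> \bar R}.

Definition sqint : {pred T -> R[i]} := mem [set f | square_integrable mu f].

Lemma sqint_submod_closed : submod_closed sqint.
Proof.
split; first by rewrite inE; exact: square_integrable0.
move=> a f g /[!inE] sf sg.
by apply: square_integrableD => //; exact: square_integrableZ.
Qed.

HB.instance Definition _ :=
  GRing.isSubmodClosed.Build _ _ sqint sqint_submod_closed.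

Record sqint_fun := SqintFun {
  sqint_val :> T -> R[i];
  sqint_valP : sqint_val \in sqint
}.

HB.instance Definition _ := [isSub for sqint_val].
HB.instance Definition _ := [Choice of sqint_fun by <:].
HB.instance Definition _ := [SubChoice_isSubLmodule of sqint_fun by <:].

Lemma sqintP (f : sqint_fun) : square_integrable mu f.
Proof. by have := sqint_valP f; rewrite inE. Qed.

Lemma sqint_valE (f : sqint_fun) : sqint_val f = val f.
Proof. by []. Qed.

Lemma sqint_valD (f g : sqint_fun) : sqint_val (f + g) = sqint_val f + g.
Proof. by rewrite !sqint_valE raddfD. Qed.

Lemma sqint_valN (f : sqint_fun) : sqint_val (- f) = - sqint_val f.
Proof. by rewrite !sqint_valE raddfN. Qed.

Lemma sqint_valB (f g : sqint_fun) : sqint_val (f - g) = sqint_val f - g.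
Proof. by rewrite sqint_valD sqint_valN. Qed.

Lemma sqint_valZ a (f : sqint_fun) : sqint_val (a *: f) = a *: sqint_val f.
Proof. by rewrite !sqint_valE linearZ_LR. Qed.

Lemma sqint_val0 : sqint_val 0 = 0.
Proof. by rewrite sqint_valE raddf0. Qed.

Definition null_fun : {pred sqint_fun} :=
  [pred f : sqint_fun | `[< {ae mu, forall x, f x = 0} >]].

Lemma null_zmod_closed : zmod_closed null_fun.
Proof.
split; first by apply/asboolP; apply: aeW => x; rewrite sqint_val0.
move=> f g /asboolP f0 /asboolP g0; apply/asboolP.
by apply: filterS2 f0 g0 => x fx gx; rewrite sqint_valB -[LHS]/(f x - g x) fx gx subr0.
Qed.

HB.instance Definition _ :=
  GRing.isZmodClosed.Build _ null_fun null_zmod_closed.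

Definition L2 : Type := Quotient.quot null_fun.

HB.instance Definition _ := GRing.Zmodule.on L2.
HB.instance Definition _ := EqQuotient.on L2.

Definition L2_class (f : sqint_fun) : L2 := \pi_L2 f.

Lemma L2_classK (F : L2) : L2_class (repr F) = F.
Proof. exact: reprK. Qed.

Lemma L2_class_eqP (f g : sqint_fun) :
  L2_class f = L2_class g <-> {ae mu, forall x, f x = g x}.
Proof.
have E : (L2_class f == L2_class g) = (f - g \in null_fun).
  by rewrite Quotient.idealrBE.
split=> [/eqP|fg]; first rewrite E => /asboolP.
  by apply: filterS => x; rewrite sqint_valB => /subr0_eq.
apply/eqP; rewrite E; apply/asboolP; apply: filterS fg => x fgx.
by rewrite sqint_valB -[LHS]/(f x - g x) fgx subrr.
Qed.

Lemma L2_classD f g : L2_class (f + g) = L2_class f + L2_class g.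
Proof. exact: raddfD. Qed.

Lemma repr_L2_class f : {ae mu, forall x, (repr (L2_class f)) x = f x}.
Proof. by apply/L2_class_eqP; rewrite L2_classK. Qed.

Definition L2_scale (a : R[i]) (F : L2) : L2 := L2_class (a *: repr F).

Lemma L2_scaleE a f : L2_scale a (L2_class f) = L2_class (a *: f).
Proof.
apply/L2_class_eqP; apply: filterS (repr_L2_class f) => x fx.
by rewrite !sqint_valZ; congr (_ * _).
Qed.

Lemma L2_scaleA a b F : L2_scale a (L2_scale b F) = L2_scale (a * b) F.
Proof. by rewrite -(L2_classK F) !L2_scaleE scalerA. Qed.

Lemma L2_scale1 : left_id 1 L2_scale.
Proof. by move=> F; rewrite -(L2_classK F) L2_scaleE scale1r. Qed.

Lemma L2_scaleDr : right_distributive L2_scale +%R.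
Proof.
move=> a F G; rewrite -(L2_classK F) -(L2_classK G) -L2_classD !L2_scaleE.
by rewrite -L2_classD scalerDr.
Qed.

Lemma L2_scaleDl F : {morph L2_scale^~ F : a b / a + b}.
Proof. by move=> a b; rewrite -(L2_classK F) !L2_scaleE scalerDl L2_classD. Qed.

HB.instance Definition _ := GRing.Zmodule_isLmodule.Build R[i] L2
  L2_scaleA L2_scale1 L2_scaleDr L2_scaleDl.

Lemma L2_classZ a f : L2_class (a *: f) = a *: L2_class f.
Proof. by rewrite -L2_scaleE. Qed.

Lemma norm2_ae (f g : sqint_fun) :
  {ae mu, forall x, f x = g x} -> norm2 mu f = norm2 mu g.
Proof.
move=> fg; rewrite /norm2; congr fine; rewrite unlock /Lnorm; congr poweR.
have mp (h : sqint_fun) :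
    measurable_fun setT (fun x => (`|normc (h x)| `^ 2)%:E).
  apply/measurable_EFinP.
  apply: (@measurableT_comp _ _ _ _ _ _ (@powR R ^~ 2)) => //.
  by apply: measurableT_comp => //; apply: cmeasurable_normc; case: (sqintP h).
apply: ae_eq_integral => //; [exact: mp|exact: mp|].
by apply: filterS fg => x fgx _ /=; rewrite fgx.
Qed.

Lemma norm2K (f : sqint_fun) :
  ((norm2 mu f)%:E = 'N[mu]_2%:E[EFin \o (@normc R \o f)])%E.
Proof.
rewrite fineK// fin_numElt (lt_le_trans ltNy0) ?Lnorm_ge0//=.
by case: (sqintP f).
Qed.

Definition L2_norm (F : L2) : R[i] := (norm2 mu (repr F))%:C.

Lemma L2_normE f : L2_norm (L2_class f) = (norm2 mu f)%:C.
Proof. by congr (_%:C); apply: norm2_ae; exact: repr_L2_class. Qed.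

Lemma ler_L2_normD F G : L2_norm (F + G) <= L2_norm F + L2_norm G.
Proof.
rewrite -(L2_classK F) -(L2_classK G) -L2_classD !L2_normE -rmorphD lecR.
rewrite -lee_fin EFinD !norm2K.
have -> : (repr F + repr G : T -> R[i]) = (repr F : T -> R[i]) + repr G.
  by rewrite sqint_valD.
by apply: Lnorm2D; [case: (sqintP (repr F))|case: (sqintP (repr G))].
Qed.

Lemma L2_normZ a F : L2_norm (a *: F) = `|a| * L2_norm F.
Proof.
rewrite -(L2_classK F) -L2_classZ !L2_normE.
have -> : `|a| = (normc a)%:C by [].
rewrite -rmorphM; congr (_%:C); apply: EFin_inj; rewrite EFinM !norm2K.
have -> : (a *: repr F : T -> R[i]) = a *: (repr F : T -> R[i]).
  by rewrite sqint_valZ.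
exact/Lnorm2Z/sqintP.
Qed.

Lemma L2_norm0_eq0 F : L2_norm F = 0 -> F = 0.
Proof.
rewrite -(L2_classK F) L2_normE => -[N0]; have := norm2K (repr F).
rewrite N0 => /esym {}N0; have [mf _] := sqintP (repr F).
have -> : 0 = L2_class 0 :> L2 by rewrite /L2_class raddf0.
apply/L2_class_eqP.
have mnf : measurable_fun setT (EFin \o (@normc R \o repr F)).
  by apply/measurable_EFinP; exact: cmeasurable_normc.
have p0 : (0 < 2%:E :> \bar R)%E by rewrite lte_fin.
apply: filterS (Lnorm_eq0_eq0 mnf p0 N0) => x Fx0.
by rewrite sqint_val0; apply: eq0_normc; apply: EFin_inj; exact: Fx0.
Qed.

HB.instance Definition _ := @Lmodule_isNormed.Build R[i] L2
  L2_norm ler_L2_normD L2_normZ L2_norm0_eq0.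

End SquareIntegrable.

Section Circle.
Context (R : realType).

Definition circle : set R[i] := [set z : R[i] | `|z| = 1].

Lemma circle1 : (1 : R[i]) \in circle.
Proof. by rewrite inE /circle /= normr1. Qed.

HB.instance Definition _ := isPointed.Build circle (SigSub circle1).

Definition borel_circle := g_sigma_algebraType (@open circle).
HB.instance Definition _ := Measurable.on borel_circle.

Definition circle_val (z : borel_circle) : R[i] := set_val z.

Lemma normc_circle (z : borel_circle) : normc (circle_val z) = 1.
Proof. by have /set_mem[] := valP z. Qed.

Lemma norm_Re (z : R[i]) : `|Re z| <= normc z.
Proof.
by case: z => a b /=; rewrite -sqrtr_sqr ler_wsqrtr// lerDl sqr_ge0.
Qed.

Lemma norm_Im (z : R[i]) : `|Im z| <= normc z.
Proof.
by case: z => a b /=; rewrite -sqrtr_sqr ler_wsqrtr// lerDr sqr_ge0.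
Qed.

Lemma continuous_Re : continuous (@Re R).
Proof.
move=> z; apply/(@cvgrPdist_lt _ _ _ (nbhs z)) => e e0.
have : \forall w \near z, `|z - w| < e%:C.
  by apply/nbhs_ballP; exists e%:C; rewrite /= ?ltcR.
apply: filterS => w; rewrite -[`|_|]/((normc _)%:C) ltcR => h.
apply: le_lt_trans h; rewrite -[_ - _]/(Re z - Re w).
have -> : Re z - Re w = Re (z - w) by case: z; case: w.
exact: norm_Re.
Qed.

Lemma continuous_Im : continuous (@Im R).
Proof.
move=> z; apply/(@cvgrPdist_lt _ _ _ (nbhs z)) => e e0.
have : \forall w \near z, `|z - w| < e%:C.
  by apply/nbhs_ballP; exists e%:C; rewrite /= ?ltcR.
apply: filterS => w; rewrite -[`|_|]/((normc _)%:C) ltcR => h.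
apply: le_lt_trans h.
have -> : Im z - Im w = Im (z - w) by case: z; case: w.
exact: norm_Im.
Qed.

Lemma measurable_circle_comp (h : R[i] -> R) :
  continuous h -> measurable_fun setT (h \o circle_val).
Proof.
move=> ch; apply: (measurability _ (RGenOpens.measurableE R)).
move=> _ [_ [a [b ->] <-]]; rewrite setTI; apply: sub_sigma_algebra.
have /continuousP ho : continuous (h \o (set_val : circle -> R[i])).
  move=> z; apply: continuous_comp; last exact: ch.
  exact: initial_continuous.
by apply: ho; exact: interval_open.
Qed.

Lemma cmeasurable_circle_val : cmeasurable circle_val.
Proof.
split; first exact: (measurable_circle_comp continuous_Re).
exact: (measurable_circle_comp continuous_Im).
Qed.

End Circle.

Section MultiplicationOperator.
Context (R : realType) (mu : {measure set (borel_circle R) -> \bar R}).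

Lemma mulz_subproof (f : sqint_fun mu) :
  (fun z => circle_val z * f z) \in sqint mu.
Proof.
have [mf lf] := sqintP f; rewrite inE; split.
  exact: (cmeasurableM (@cmeasurable_circle_val R) mf).
rewrite /finite_norm (@eq_Lnorm _ _ _ _ _ _ (EFin \o (@normc R \o f)))//.
by move=> z /=; rewrite normcM normc_circle mul1r.
Qed.

Definition mulz_fun (f : sqint_fun mu) : sqint_fun mu :=
  SqintFun (mulz_subproof f).

Definition mulz (F : L2 mu) : L2 mu := L2_class (mulz_fun (repr F)).

Lemma mulzE f : mulz (L2_class f) = L2_class (mulz_fun f).
Proof.
apply/L2_class_eqP; apply: filterS (repr_L2_class f) => z fz.
by rewrite /= fz.
Qed.

Lemma mulz_linear : linear mulz.
Proof.
move=> a F G; rewrite -(L2_classK F) -(L2_classK G) -L2_classZ -L2_classD.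
rewrite !mulzE -L2_classZ -L2_classD; apply/L2_class_eqP; apply: aeW => z.
rewrite -[LHS]/(circle_val z * sqint_val (a *: repr F + repr G) z).
rewrite !sqint_valD !sqint_valZ.
rewrite -[LHS]/(circle_val z * (a * repr F z + repr G z)).
by rewrite mulrDr mulrCA.
Qed.

HB.instance Definition _ :=
  GRing.isLinear.Build R[i] (L2 mu) (L2 mu) _ mulz mulz_linear.

Lemma mulz_isometry (F : L2 mu) : `|mulz F| = `|F|.
Proof.
rewrite -[LHS]/(L2_norm _) -[RHS]/(L2_norm _) -(L2_classK F) mulzE !L2_normE.
congr (_%:C); rewrite /norm2; congr fine; apply: eq_Lnorm => z /=.
by rewrite normcM normc_circle mul1r.
Qed.

Lemma mulz_continuous : continuous mulz.
Proof.
move=> F; apply/(@cvgrPdist_lt _ _ _ (nbhs F)) => e e0.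
apply/nbhs_ballP; exists e => // G; rewrite -ball_normE /= => FG.
by rewrite -linearB mulz_isometry.
Qed.

Definition fourier_coef (n : int) : R[i] :=
  cintegral mu (fun z => circle_val z ^ n).

Definition vanishing_fourier :=
  forall e : R, 0 < e -> exists N : nat,
    forall n : int, (N <= `|n|)%N -> normc (fourier_coef n) < e.

End MultiplicationOperator.

Arguments mulz {R} mu F.

(* Main.v *)
Require Import Defs.
From HB Require Import structures.
From mathcomp Require Import all_boot all_order all_algebra.
From mathcomp Require Import all_classical all_reals all_analysis measurable_realfun.
From mathcomp Require Import complex.
From mathcomp Require Import ring lra.
Import Order.TTheory GRing.Theory Num.Theory.
Import numFieldNormedType.Exports.
Local Open Scope classical_set_scope.
Local Open Scope ring_scope.

(** Write M for multiplication by z and let a_k M^(n_k) f converge weakly to a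
nonzero l. Weakly convergent sequences are bounded in norm and M is an
isometry, so (unless f = 0) the scalars a_k are bounded. On the other hand
M^n -> 0 in the weak operator topology, because the Fourier coefficients of mu
vanish at infinity. If n_k were unbounded, then along a subsequence
<a_k M^(n_k) f, l> would tend to 0, whereas it tends to <l, l> > 0. So some
value n is taken infinitely often by n_k, and l lies on the line through
M^n f, since a line is weakly closed. As 0 is in the orbit as well, the
projective orbit is weakly sequentially closed.

Weak convergence is tested against the functionals <., G>, and, to get
boundedness, against the sum of a lacunary series of such functionals
([uniform_boundedness], [weakly_convergent_bounded]).

That M^n -> 0 weakly ([inner_iter_mulz_cvg0]) means that h mu has Fourier
coefficients vanishing at infinity for every integrable h
([rajchman_integrable]). The reason is that the bounded functions whose product
with any density having this property has it again form an algebra closed under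
bounded pointwise limits; it contains Re z and Im z, hence the indicators of
half planes (the sign function is a limit of polynomials), hence those of all
Borel sets.

If M were weakly sequentially supercyclic, the orbit of some f, being closed,
would be the whole space. All elements of the orbit have modulus proportional
to |f|, so any two positive functions of L2 would be proportional. Applied to
2, 2 + Re z and 2 + Im z, this makes z constant almost everywhere, mu is a
point mass, and its Fourier coefficients have constant modulus
([not_weakly_seq_supercyclic_mulz]). *)

Set Implicit Arguments.
Unset Strict Implicit.

(** * Integrability preliminaries *)

Section Preliminaries.
Context d (T : measurableType d) (R : realType) (mu : {measure set T -> \bar R}).
Local Notation normc := (@Normc.normc R).

Lemma normc_le (w : R[i]) :
  normc w <= `|complex.Re w| + `|complex.Im w|.
Proof.
case: w => a b /=; rewrite -[leRHS]ger0_norm ?addr_ge0// -sqrtr_sqr ler_wsqrtr//.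
by rewrite sqrrD !real_normK ?num_real// lerD2r lerDl mulrn_wge0// mulr_ge0.
Qed.

Lemma integrableZ a (g : T -> R) : mu.-integrable setT (EFin \o g) ->
  mu.-integrable setT (EFin \o (fun x => a * g x)).
Proof. exact: (@integrableZl _ _ _ _ _ measurableT a). Qed.

Lemma measurable_integrable (g : T -> R) :
  mu.-integrable setT (EFin \o g) -> measurable_fun setT g.
Proof. by move=> ig; exact/measurable_EFinP/(measurable_int mu). Qed.

Lemma integrableM_bounded (g h : T -> R) (M : R) :
  mu.-integrable setT (EFin \o g) -> measurable_fun setT h ->
  (forall x, `|h x| <= M) -> mu.-integrable setT (EFin \o (fun x => g x * h x)).
Proof.
move=> ig mh hM; have mg := measurable_integrable ig.
apply: (le_integrable measurableT _ _ (integrableZ M ig)) => //.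
  by apply/measurable_EFinP; exact: measurable_funM.
move=> x _ /=; rewrite lee_fin normrM [leRHS]normrM mulrC ler_wpM2r//.
exact: le_trans (hM x) (ler_norm _).
Qed.

End Preliminaries.

(** * The uniform boundedness principle *)

Section UniformBoundedness.
Context (R : realType).
Local Notation normc := (@Normc.normc R).

(** The intervals centred at v_n, of radius the sum of the remaining bounds, are
nested; the limit is the supremum of their left ends. *)
Lemma geometric_cauchy (v : nat -> R) (C : R) :
  (forall n, `|v n.+1 - v n| <= C * 4^-1 ^+ n) ->
  exists l, forall n, `|l - v n| <= 4 / 3 * C * 4^-1 ^+ n.
Proof.
move=> vC.
pose r n : R := 4 / 3 * C * 4^-1 ^+ n; pose a n := v n - r n; pose b n := v n + r n.
have C0 : 0 <= C by have := vC 0%N; rewrite expr0 mulr1; apply: le_trans.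
have r0 n : 0 <= r n by rewrite /r !mulr_ge0// exprn_ge0.
have rS n : r n - r n.+1 = C * 4^-1 ^+ n by rewrite /r exprS; lra.
have aS : {homo a : n m / (n <= m)%N >-> n <= m}.
  apply: homo_leq => [//|? ? ?|n]; first exact: le_trans.
  have := vC n; rewrite -rS ler_norml /a => /andP[? ?]; lra.
have bS : {homo b : n m / (n <= m)%N >-> m <= n}.
  apply: homo_leq => [//|y x z|n]; first by move=> ? /le_trans; exact.
  have := vC n; rewrite -rS ler_norml /b => /andP[? ?]; lra.
have ab n m : a n <= b m.
  apply: (@le_trans _ _ (a (maxn n m))); first exact/aS/leq_maxl.
  apply: (@le_trans _ _ (b (maxn n m))); last exact/bS/leq_maxr.
  by rewrite /a /b; have := r0 (maxn n m); lra.
exists (sup (range a)) => n; rewrite -/(r n).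
have h1 : a n <= sup (range a).
  by apply: ub_le_sup; [exists (b 0%N) => _ [m _ <-]|exists n].
have h2 : sup (range a) <= b n.
  by apply: ge_sup; [exists (a 0%N); exists 0%N|move=> _ [m _ <-]].
by rewrite ler_norml; move: h1 h2; rewrite /a /b => ? ?; apply/andP; split; lra.
Qed.

(** The real and imaginary parts converge separately, which costs the factor 2
between 4/3 and 8/3. *)
Lemma geometric_cauchyC (v : nat -> R[i]) (C : R) :
  (forall n, normc (v n.+1 - v n) <= C * 4^-1 ^+ n) ->
  exists l, forall n, normc (l - v n) <= 8 / 3 * C * 4^-1 ^+ n.
Proof.
move=> vC.
have [|x hx] := @geometric_cauchy (fun n => complex.Re (v n)) C.
  move=> n /=; apply: le_trans (vC n); apply: le_trans (norm_Re _).
  by case: (v n); case: (v n.+1).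
have [|y hy] := @geometric_cauchy (fun n => complex.Im (v n)) C.
  move=> n /=; apply: le_trans (vC n); apply: le_trans (norm_Im _).
  by case: (v n); case: (v n.+1).
exists (x +i* y)%C => n; apply: le_trans (normc_le _) _.
have /= := hx n; have /= := hy n.
by case: (v n) => a b /=; lra.
Qed.

Lemma geometric_le0 (y C : R) : (forall n, y <= C * 4^-1 ^+ n) -> y <= 0.
Proof.
move=> yC; have h : (C * 4^-1 ^+ n) @[n --> \oo] --> C * 0.
  apply: cvgM; first exact: cvg_cst.
  by apply: cvg_expr; rewrite ger0_norm; lra.
rewrite -(mulr0 C) -(cvg_lim (@Rhausdorff R) h).
by apply: limr_ge; [apply/cvg_ex; exists (C * 0)|exact: nearW].
Qed.

Lemma ge0_complexE (z : R[i]) : 0 <= z -> z = (complex.Re z)%:C%C.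
Proof. by case: z => a b; rewrite lecE => /andP[/eqP /= -> _]. Qed.

Context (V : normedModType R[i]).

Lemma norm_complexE (v : V) : `|v| = (complex.Re `|v|)%:C%C.
Proof. exact: ge0_complexE. Qed.

(** The norm of a normed module over R[i] takes its values in R[i], where the
order is partial; this is the same number seen in R. *)
Definition rnorm (v : V) : R := complex.Re `|v|.

Lemma rnorm_ge0 (v : V) : 0 <= rnorm v.
Proof. by have := normr_ge0 v; rewrite [`|v|]norm_complexE lecR. Qed.

Lemma rnormZ a (v : V) : rnorm (a *: v) = normc a * rnorm v.
Proof.
by rewrite /rnorm normrZ [`|v|]norm_complexE -[`|a|]/((normc a)%:C)%C -rmorphM.
Qed.

Lemma rnorm_eq0 (v : V) : rnorm v = 0 -> v = 0.
Proof.
by move=> v0; apply/eqP; rewrite -normr_eq0 norm_complexE -/(rnorm v) v0.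
Qed.

Lemma bounded_functional_continuous (f : {linear V -> R[i]^o}) (C : R) :
  (forall v, normc (f v) <= C * rnorm v) -> continuous f.
Proof.
move=> fC; apply: bounded_linear_continuous; apply/linear_boundedP.
exists C%:C%C; split; first by rewrite complex_real.
move=> r Cr v; apply: (@le_trans _ _ (C%:C%C * `|v|)); last first.
  by rewrite ler_wpM2r// ltW.
by rewrite norm_complexE -rmorphM -[`|f v|]/((normc (f v))%:C)%C lecR.
Qed.

(** A. Sokal's proof of the uniform boundedness principle. For any functional p
and any t, one of p + t and p - t is at least as large as t in modulus, since
they differ by 2t. So, adding 4^-n e_n with a well chosen sign at step n, a
functional is built whose value at x_n is comparable with 4^-n |x_n|: the later
steps contribute too little to cancel it. The limit is taken pointwise. *)
Section Hump.
Variables (e : nat -> {linear V -> R[i]^o}) (x : nat -> V).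
Hypothesis e1 : forall n v, normc (e n v) <= rnorm v.
Hypothesis ex : forall n, normc (e n (x n)) = rnorm (x n).

Let q (n : nat) : R[i] := (4^-1 ^+ n)%:C%C.

(** The n-th partial sum, with the sign at step m chosen by looking at x_m. *)
Fixpoint hump n : V -> R[i] :=
  if n is m.+1 then fun v => hump m v +
    (if rnorm (x m) * 4^-1 ^+ m <= normc (hump m (x m) + q m * e m (x m))
     then 1 else -1) * q m * e m v
  else fun=> 0.

Lemma hump_linear n a u v : hump n (a *: u + v) = a * hump n u + hump n v.
Proof.
elim: n => [|n ih] /=; first by rewrite mulr0 addr0.
rewrite ih linearP -[_ *: _]/(_ * _).
set c := _ * q n. ring.
Qed.

Let normcq n : normc (q n) = 4^-1 ^+ n.
Proof. by rewrite /q /= expr0n addr0 sqrtr_sqr ger0_norm// exprn_ge0. Qed.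

Lemma hump_step n v : normc (hump n.+1 v - hump n v) <= rnorm v * 4^-1 ^+ n.
Proof.
rewrite /= addrAC subrr add0r !Normc.normcM normcq.
set c := (if _ then _ else _); have -> : normc c = 1.
  by rewrite /c; case: ifP => _ /=; rewrite ?sqrrN expr1n expr0n addr0 sqrtr1.
by rewrite mul1r mulrC ler_wpM2r// exprn_ge0.
Qed.

Lemma hump_ge n : rnorm (x n) * 4^-1 ^+ n <= normc (hump n.+1 (x n)).
Proof.
rewrite /=; case: ifP => [|/negbT]; first by rewrite mul1r.
rewrite -ltNge mulN1r mulNr; set p := hump n _; set t := q n * _ => pt.
have tE : normc t = rnorm (x n) * 4^-1 ^+ n.
  by rewrite /t Normc.normcM normcq ex mulrC.
have := le_normcD (p + t) (- (p - t)).
have -> : p + t + - (p - t) = t *+ 2 by rewrite mulr2n; ring.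
by rewrite normcMn normcN mulr2n; lra.
Qed.

Lemma hump_limit : exists2 phi : {linear V -> R[i]^o}, continuous phi &
  forall n, rnorm (x n) * 4^-1 ^+ n / 3 <= normc (phi (x n)).
Proof.
have phiP v : {l | forall n, normc (l - hump n v) <= 8 / 3 * rnorm v * 4^-1 ^+ n}.
  by apply/cid/geometric_cauchyC => n; exact: hump_step.
pose phi v : R[i]^o := sval (phiP v).
have phi_hump v n : normc (phi v - hump n v) <= 8 / 3 * rnorm v * 4^-1 ^+ n.
  exact: (svalP (phiP v)).
have phi_lin : linear phi.
  move=> a u v; apply/eqP; rewrite -subr_eq0; apply/eqP/Normc.eq0_normc.
  apply/eqP; rewrite eq_le normc_ge0 andbT.
  (* [hump n] is linear and 4^-n close to phi, so the defect is O(4^-n). *)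
  pose C := 8 / 3 * rnorm (a *: u + v) + normc a * (8 / 3 * rnorm u) + 8 / 3 * rnorm v.
  apply: (@geometric_le0 _ C) => n.
  have -> : phi (a *: u + v) - (a *: phi u + phi v) =
     (phi (a *: u + v) - hump n (a *: u + v)) +
     (- (a * (phi u - hump n u)) + - (phi v - hump n v)).
    by rewrite hump_linear -[a *: phi u]/(a * phi u); ring.
  apply: le_trans (le_normcD _ _) _; rewrite /C -addrA mulrDl.
  apply: lerD; first exact: phi_hump.
  apply: le_trans (le_normcD _ _) _; rewrite mulrDl.
  rewrite !normcN Normc.normcM.
  by apply: lerD; rewrite ?phi_hump// -[leRHS]mulrA ler_wpM2l ?normc_ge0 ?phi_hump.
pose Lphi := HB.pack phi (GRing.isLinear.Build _ _ _ _ phi phi_lin) : {linear V -> R[i]^o}.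
exists Lphi.
  apply: (@bounded_functional_continuous _ (8 / 3)) => v.
  by have := phi_hump v 0%N; rewrite /= subr0 expr0 mulr1.
move=> n; rewrite -[Lphi _]/(phi _).
have h1 := phi_hump (x n) n.+1; have h2 := hump_ge n.
(* The steps after n move the value by at most 8/3 * 4^-(n+1) = 2/3 * 4^-n
   times |x_n|, which leaves a third of the lower bound. *)
have := le_normcD (phi (x n)) (- (phi (x n) - hump n.+1 (x n))).
rewrite normcN opprB addrC subrK.
move: h1; rewrite exprS; lra.
Qed.
End Hump.

(** Norming functionals e_n of the x_n are taken as data: in an inner product
space they are the pairings with x_n / |x_n|. *)
Lemma uniform_boundedness (e : nat -> {linear V -> R[i]^o}) (x : nat -> V) :
  (forall n v, normc (e n v) <= rnorm v) -> (forall n, normc (e n (x n)) = rnorm (x n)) ->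
  (forall phi : {linear V -> R[i]^o}, continuous phi ->
     exists M, forall n, normc (phi (x n)) <= M) ->
  exists M, forall n, rnorm (x n) <= M.
Proof.
move=> e1 ex bd; apply: contrapT => nb.
(* Norms above 8^n beat the factor 4^-n of [hump_limit]. *)
have /choice[k hk] : forall n : nat, exists k, 8 ^+ n <= rnorm (x k).
  move=> n; apply: contrapT => h; apply: nb; exists (8 ^+ n) => k.
  by rewrite leNgt; apply/negP => lt; apply: h; exists k; exact: ltW.
have [phi cphi phix] := @hump_limit (e \o k) (x \o k)
  (fun n => e1 (k n)) (fun n => ex (k n)).
have [M hM] := bd _ cphi.
pose n := (Num.trunc (3 * M)).+1.
have M3 : 3 * M < n%:R := truncnS_gt _.
have h2 : n%:R <= 2 ^+ n :> R by rewrite -natrX ler_nat ltnW// ltn_expl.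
have := le_trans (phix n) (hM (k n)); rewrite /=.
have : 2 ^+ n <= rnorm (x (k n)) * 4^-1 ^+ n.
  have -> : 2 ^+ n = 8 ^+ n * 4^-1 ^+ n :> R by rewrite -exprMn; congr (_ ^+ _); lra.
  by rewrite ler_wpM2r// exprn_ge0.
lra.
Qed.
End UniformBoundedness.

(** * The inner product of square-integrable functions *)

Section InnerProduct.
Local Open Scope complex_scope.
Context d (T : measurableType d) (R : realType) (mu : {measure set T -> \bar R}).
Local Notation normc := (@Normc.normc R).
Local Notation Re := complex.Re.
Local Notation Im := complex.Im.

Definition cintegrable (h : T -> R[i]) :=
  mu.-integrable setT (EFin \o (fun x => Re (h x))) /\
  mu.-integrable setT (EFin \o (fun x => Im (h x))).

Lemma cintegralD g h : cintegrable g -> cintegrable h ->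
  cintegral mu (fun x => g x + h x) = cintegral mu g + cintegral mu h.
Proof.
move=> [gr gi] [hr hi]; rewrite /cintegral; apply/eqP; rewrite eq_complex /=.
rewrite -!RintegralD//; apply/andP; split; apply/eqP; apply: eq_Rintegral => x _.
  by rewrite Defs.ReD.
by rewrite Defs.ImD.
Qed.

Lemma cintegralZ a h : cintegrable h ->
  cintegral mu (fun x => a * h x) = a * cintegral mu h.
Proof.
move=> [hr hi]; rewrite /cintegral; case: a => a b.
have iZ c g : mu.-integrable setT (EFin \o g) ->
  mu.-integrable setT (EFin \o (fun x => c * g x)) by exact: integrableZ.
apply/eqP; rewrite eq_complex /= -!RintegralZl// -RintegralD// -?RintegralB//;
  try exact: iZ.
apply/andP; split; apply/eqP; apply: eq_Rintegral => x _.
  by rewrite Defs.ReM.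
by rewrite Defs.ImM.
Qed.

Lemma eq_ae_cintegral g h : cmeasurable g -> cmeasurable h ->
  {ae mu, forall x, g x = h x} -> cintegral mu g = cintegral mu h.
Proof.
move=> [gr gi] [hr hi] gh; rewrite /cintegral /Rintegral.
congr (fine _ +i* fine _); apply: ae_eq_integral => //; try exact/measurable_EFinP.
  by apply: filterS gh => x /= ->.
by apply: filterS gh => x /= ->.
Qed.

Lemma dot_le_normc (z w : R[i]) : Re z * Re w + Im z * Im w <= normc z * normc w.
Proof.
rewrite -Normc.normcM.
have -> : normc (z * w) = normc (z * w^*).
  rewrite !Normc.normcM; congr (_ * _).
  by case: w => a b /=; rewrite sqrrN.
apply: le_trans (norm_Re _); apply: le_trans (ler_norm _).
by rewrite Defs.ReM; case: z; case: w => a b c e /=; rewrite mulrN opprK.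
Qed.

(** Multiply the integral I by its conjugate: |I|^2 is the integral of the real
part of conj(I) h, which is at most |I| |h|. *)
Lemma normc_cintegral_le h : cintegrable h ->
  mu.-integrable setT (EFin \o (fun x => normc (h x))) ->
  normc (cintegral mu h) <= \int[mu]_x normc (h x).
Proof.
move=> [hr hi] hn; set I := cintegral mu h.
have [I0|I0] := eqVneq (normc I) 0.
  by rewrite I0; apply: Rintegral_ge0 => x _; exact: normc_ge0.
have Igt : 0 < normc I by rewrite lt0r I0 normc_ge0.
rewrite -(ler_pM2l Igt).
have -> : normc I * normc I = Re I * Re I + Im I * Im I.
  by case: I I0 Igt => a b /= _ _; rewrite -!expr2 sqr_sqrtr// addr_ge0 ?sqr_ge0.
rewrite {2 4}/I /= -!RintegralZl// -RintegralD//; try exact: integrableZ.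
apply: le_Rintegral => //; try exact: integrableZ.
  exact: (integrableD measurableT (integrableZ _ hr) (integrableZ _ hi)).
by move=> x _; exact: (dot_le_normc I).
Qed.

Lemma sqint_Lfun2 (f : sqint_fun mu) : (fun x => normc (f x)) \in Lfun mu 2%:E.
Proof.
have [mf lf] := sqintP f.
by apply/andP; split; rewrite inE//=; exact: cmeasurable_normc.
Qed.

Lemma conjc_cmeasurable (f : T -> R[i]) : cmeasurable f -> cmeasurable (fun x => (f x)^*).
Proof.
move=> [mr mi]; split.
  by apply: eq_measurable_fun mr => x _; case: (f x).
apply: (@eq_measurable_fun _ _ _ _ _ (fun x => - Im (f x))); last exact: measurableT_comp.
by move=> x _; case: (f x).
Qed.

Lemma normc_conjc (z : R[i]) : normc z^* = normc z.
Proof. by case: z => a b /=; rewrite sqrrN. Qed.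

Definition pairing (f g : sqint_fun mu) (x : T) : R[i] := f x * (g x)^*.

Lemma normc_real (x : R) : normc x%:C = `|x|.
Proof. by rewrite /= expr0n addr0 sqrtr_sqr. Qed.

Lemma normc_pairing f g x : normc (pairing f g x) = normc (f x) * normc (g x).
Proof. by rewrite Normc.normcM normc_conjc. Qed.

Lemma pairing_cmeasurable f g : cmeasurable (pairing f g).
Proof.
have [mf _] := sqintP f; have [mg _] := sqintP g.
exact: cmeasurableM mf (conjc_cmeasurable mg).
Qed.

Lemma integrable_normc_pairing f g :
  mu.-integrable setT (EFin \o (fun x => normc (pairing f g x))).
Proof.
under [X in EFin \o X]eq_fun do rewrite normc_pairing.
by have /Lfun1_integrable := Lfun2_mul_Lfun1 (sqint_Lfun2 f) (sqint_Lfun2 g).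
Qed.

Lemma pairing_cintegrable f g : cintegrable (pairing f g).
Proof.
have [mr mi] := pairing_cmeasurable f g; have ip := integrable_normc_pairing f g.
split; apply: (le_integrable measurableT _ _ ip); try exact/measurable_EFinP.
  by move=> x _ /=; rewrite lee_fin [leRHS]ger0_norm ?normc_ge0 ?norm_Re.
by move=> x _ /=; rewrite lee_fin [leRHS]ger0_norm ?normc_ge0 ?norm_Im.
Qed.

Lemma Rintegral_normc_pairing_le f g :
  \int[mu]_x normc (pairing f g x) <= norm2 mu f * norm2 mu g.
Proof.
have [mf _] := sqintP f; have [mg _] := sqintP g.
rewrite -lee_fin EFinM !norm2K.
have := hoelder mu (cmeasurable_normc mf) (cmeasurable_normc mg)
  (ltr0n R 2) (ltr0n R 2).
have -> : 2^-1 + 2^-1 = 1 :> R by rewrite [RHS](splitr 1) div1r.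
move=> /(_ erefl); apply: le_trans; rewrite Lnorm1.
rewrite fineK; last first.
  by apply: integrable_fin_num => //; exact: integrable_normc_pairing.
apply: ge0_le_integral => //.
- by move=> x _; rewrite lee_fin normc_ge0.
- exact: (measurable_int mu (integrable_normc_pairing f g)).
- apply/measurable_EFinP; apply: measurableT_comp => //.
  by apply: measurable_funM; exact: cmeasurable_normc.
- by move=> x _; rewrite /= lee_fin normc_pairing ler_norm.
Qed.

Lemma norm2_sqr (f : sqint_fun mu) : norm2 mu f ^+ 2 = \int[mu]_x (normc (f x)) ^+ 2.
Proof.
rewrite -powR_mulrn ?fine_ge0 ?Lnorm_ge0//.
apply: EFin_inj; rewrite -poweR_EFin norm2K powR_Lnorm//.
rewrite fineK; last first.
  apply: integrable_fin_num => //.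
  have := integrable_normc_pairing f f.
  by under [X in EFin \o X]eq_fun do rewrite normc_pairing -expr2.
apply: eq_integral => x _ /=.
by rewrite powR_mulrn// ger0_norm ?normc_ge0.
Qed.

Lemma cintegral_pairing_diag (f : sqint_fun mu) :
  cintegral mu (pairing f f) = (norm2 mu f ^+ 2)%:C.
Proof.
rewrite norm2_sqr /cintegral; congr (_ +i* _).
  apply: eq_Rintegral => x _; rewrite /pairing.
  by case: (f x) => a b /=; rewrite mulrN opprK sqr_sqrtr ?addr_ge0 ?sqr_ge0.
have -> : 0 = \int[mu]_(x in setT) (0 : R) by rewrite Rintegral_cst// mul0r.
apply: eq_Rintegral => x _; rewrite /pairing.
by case: (f x) => a b /=; lra.
Qed.

Lemma normc_cintegral_pairing_le (f g : sqint_fun mu) :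
  normc (cintegral mu (pairing f g)) <= norm2 mu f * norm2 mu g.
Proof.
apply: le_trans (Rintegral_normc_pairing_le f g).
apply: normc_cintegral_le; first exact: pairing_cintegrable.
exact: integrable_normc_pairing.
Qed.

Definition inner (F G : L2 mu) : R[i] := cintegral mu (pairing (repr F) (repr G)).

Lemma innerE f g : inner (L2_class f) (L2_class g) = cintegral mu (pairing f g).
Proof.
apply: eq_ae_cintegral; try exact: pairing_cmeasurable.
apply: filterS2 (repr_L2_class f) (repr_L2_class g) => x fx gx.
by rewrite /pairing fx gx.
Qed.

(** The functional <., G>, named so that it can carry a linear structure. *)
Definition inner_with (G F : L2 mu) : R[i]^o := inner F G.

Lemma inner_linear G : linear (inner_with G).
Proof.
move=> a F1 F2; rewrite -[LHS]/(inner _ _) -[RHS]/(a * inner F1 G + inner F2 G).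
rewrite -(L2_classK F1) -(L2_classK F2) -(L2_classK G).
rewrite -L2_classZ -L2_classD !innerE.
rewrite -cintegralZ; last exact: pairing_cintegrable.
rewrite -cintegralD; last exact: pairing_cintegrable.
  congr cintegral; apply/funext => x; rewrite /pairing sqint_valD sqint_valZ.
  rewrite -[(_ + _) x]/(a * repr F1 x + repr F2 x); ring.
have := pairing_cintegrable (a *: repr F1) (repr G).
congr cintegrable; apply/funext => x; rewrite /pairing sqint_valZ.
by rewrite -[(_ *: _) x]/(a * repr F1 x) mulrA.
Qed.

HB.instance Definition _ G :=
  GRing.isLinear.Build R[i] (L2 mu) R[i]^o _ (inner_with G) (@inner_linear G).

Lemma rnorm_L2_class (f : sqint_fun mu) : rnorm (L2_class f) = norm2 mu f.
Proof. by rewrite /rnorm -[`|_|]/(L2_norm _) L2_normE. Qed.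

Lemma inner_diag F : inner F F = (rnorm F ^+ 2)%:C.
Proof. by rewrite -(L2_classK F) innerE rnorm_L2_class cintegral_pairing_diag. Qed.

Lemma normc_inner_le F G : normc (inner F G) <= rnorm F * rnorm G.
Proof.
rewrite -(L2_classK F) -(L2_classK G) innerE !rnorm_L2_class.
exact: normc_cintegral_pairing_le.
Qed.

Lemma inner_continuous G : continuous (inner_with G).
Proof.
apply: (@bounded_functional_continuous _ _ (inner_with G) (rnorm G)) => F.
by rewrite mulrC; exact: normc_inner_le.
Qed.

Lemma inner_conjZ F a G : inner F (a *: G) = a^* * inner F G.
Proof.
rewrite -(L2_classK F) -(L2_classK G) -L2_classZ !innerE.
rewrite -cintegralZ; last exact: pairing_cintegrable.
congr cintegral; apply/funext => x; rewrite /pairing sqint_valZ.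
by rewrite -[(_ *: _) x]/(a * repr G x) rmorphM mulrCA.
Qed.

Lemma inner_conjD F G H : inner F (G + H) = inner F G + inner F H.
Proof.
rewrite -(L2_classK F) -(L2_classK G) -(L2_classK H) -L2_classD !innerE.
rewrite -cintegralD; try exact: pairing_cintegrable.
congr cintegral; apply/funext => x; rewrite /pairing sqint_valD.
by rewrite -[(_ + _) x]/(repr G x + repr H x) rmorphD mulrDr.
Qed.

(** A weakly convergent sequence has bounded image under each continuous
functional, and the pairings with u_n / |u_n| are norming. *)
Lemma weakly_convergent_bounded (u : nat -> L2 mu) (l : L2 mu) :
  u @ \oo --> (l : weak_space (L2 mu)) -> exists M, forall n, rnorm (u n) <= M.
Proof.
move=> /cvg_weak_space ul.
(* As 0^-1 = 0, this is also a norming vector when u_n = 0. *)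
pose y n := (rnorm (u n))^-1%:C *: u n.
have yn n : rnorm (y n) <= 1.
  rewrite rnormZ /= expr0n addr0 sqrtr_sqr ger0_norm ?invr_ge0 ?rnorm_ge0//.
  by have [->|?] := eqVneq (rnorm (u n)) 0; rewrite ?mulr0// mulVf.
apply: (@uniform_boundedness _ _ (fun n => inner_with (y n) : {linear L2 mu -> R[i]^o})).
- move=> n v; apply: le_trans (normc_inner_le _ _) _.
  by rewrite ler_piMr// rnorm_ge0.
- move=> n; rewrite -[X in normc X = _]/(inner (u n) (y n)) /y inner_conjZ inner_diag.
  rewrite Normc.normcM normc_conjc !normc_real.
  rewrite !ger0_norm ?sqr_ge0 ?invr_ge0 ?rnorm_ge0//.
  have [->|h] := eqVneq (rnorm (u n)) 0; first by rewrite expr2 !mulr0.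
  by rewrite expr2 mulKf.
move=> phi cphi; have cv := ul phi cphi.
have /cvg_seq_bounded [M [Mr hM]] : cvgn (phi \o u : nat -> R[i]^o).
  by apply/cvg_ex; exists (phi l).
exists (complex.Re (M + 1)) => n.
have := hM (M + 1); rewrite ltrDl ltr01 => /(_ isT n I) /= h.
have M1 : 0 <= M + 1 by apply: le_trans h.
by move: h; rewrite (ge0_complexE M1) -[`|_|]/((normc _)%:C) lecR.
Qed.

End InnerProduct.

(** * Integrals against a bounded sequence of functions *)

Section Vanishing.
Context d (T : measurableType d) (R : realType) (mu : {measure set T -> \bar R}).

Variable w : nat -> T -> R.
Hypothesis mw : forall n, measurable_fun setT (w n).
Hypothesis w1 : forall n x, `|w n x| <= 1.

Definition vanishing (g : T -> R) :=
  mu.-integrable setT (EFin \o g) /\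
  (\int[mu]_x (g x * w n x) @[n --> \oo] --> (0 : R)).

Lemma integrable_wave g n : mu.-integrable setT (EFin \o g) ->
  mu.-integrable setT (EFin \o (fun x => g x * w n x)).
Proof. by move=> ig; exact: (integrableM_bounded ig (mw n) (w1 n)). Qed.

Lemma vanishingD g h : vanishing g -> vanishing h ->
  vanishing (fun x => g x + h x).
Proof.
move=> [ig vg] [ih vh]; split; first exact: (integrableD measurableT ig ih).
have -> : (fun n => \int[mu]_x ((g x + h x) * w n x)) =
  (fun n => \int[mu]_x (g x * w n x) + \int[mu]_x (h x * w n x)).
  apply/funext => n; rewrite -RintegralD//; try exact: integrable_wave.
  by apply: eq_Rintegral => x _; rewrite mulrDl.
by rewrite -[X in _ --> X](addr0 0); exact: cvgD.
Qed.

Lemma vanishingZ a g : vanishing g -> vanishing (fun x => a * g x).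
Proof.
move=> [ig vg]; split; first exact: integrableZ.
have -> : (fun n => \int[mu]_x ((a * g x) * w n x)) =
  (fun n => a * \int[mu]_x (g x * w n x)).
  apply/funext => n; rewrite -RintegralZl//; last exact: integrable_wave.
  by apply: eq_Rintegral => x _; rewrite mulrA.
by rewrite -[X in _ --> X](mulr0 a); apply: cvgM => //; exact: cvg_cst.
Qed.

(** The functions w_n are bounded by 1, so that an L1-small change of g changes
all the integrals by a small amount, uniformly in n. *)
Lemma vanishing_L1 (g_ : nat -> T -> R) (g : T -> R) :
  (forall k, vanishing (g_ k)) -> mu.-integrable setT (EFin \o g) ->
  ((\int[mu]_x `|g_ k x - g x|%:E)%E @[k --> \oo] --> 0%E) ->
  vanishing g.
Proof.
move=> vg ig dist0; split=> //; apply/cvgr0Pnorm_lt => e e0.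
have /fine_cvgP[_ /cvgr0Pnorm_lt /(_ (e / 2))] := dist0.
case; first by rewrite divr_gt0.
move=> k _ /(_ k (leqnn k)) /=; set D := fine _ => De.
have [_ /cvgr0Pnorm_lt/(_ (e / 2))] := vg k.
have -> : 0 < e / 2 by rewrite divr_gt0.
move=> /(_ isT); apply: filterS => n gke.
have igk := (vg k).1.
have id : mu.-integrable setT (EFin \o (fun x => g_ k x - g x)).
  exact: (integrableB measurableT igk ig).
have -> : \int[mu]_x (g x * w n x) =
    \int[mu]_x (g_ k x * w n x) - \int[mu]_x ((g_ k x - g x) * w n x).
  rewrite -RintegralB//; try exact: integrable_wave.
  by apply: eq_Rintegral => x _; rewrite mulrBl opprB addrC subrK.
rewrite (splitr e); apply: le_lt_trans (ler_normB _ _) _; apply: ltrD => //.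
apply: le_lt_trans De; apply: le_trans (ler_norm D).
apply: le_trans (le_normr_Rintegral measurableT (integrable_wave _ id)) _.
apply: le_Rintegral => //.
- exact: (integrable_abse (integrable_wave _ id)).
- exact: (integrable_abse id).
- by move=> x _; rewrite normrM ler_piMr.
Qed.

Lemma vanishing_dominated (g_ : nat -> T -> R) (g G : T -> R) :
  (forall k, vanishing (g_ k)) -> mu.-integrable setT (EFin \o G) ->
  (forall k x, `|g_ k x| <= G x) -> (forall x, g_ k x @[k --> \oo] --> g x) ->
  vanishing g.
Proof.
move=> vg iG gG gg.
have mg_ k : measurable_fun setT (g_ k) := measurable_integrable (vg k).1.
have mg : measurable_fun setT g.
  by apply: (measurable_fun_cvg mg_) => x _; exact: gg.
have [||||| ig dist0 _] := @dominated_convergence _ _ _ mu setT measurableT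
  (fun k => EFin \o g_ k) (EFin \o g) (EFin \o G).
- by move=> k; apply/measurable_EFinP.
- exact/measurable_EFinP.
- by apply: aeW => x _; apply: cvg_EFin; [exact: nearW|exact: gg].
- exact: iG.
- by apply: aeW => x k _ /=; rewrite lee_fin.
- exact: vanishing_L1 vg ig dist0.
Qed.
End Vanishing.

(** * Densities with vanishing Fourier coefficients *)

Section Rajchman.
Import HBSimple.
Context (R : realType) (mu : {finite_measure set (borel_circle R) -> \bar R}).
Local Notation T := (borel_circle R).
Local Notation Re := complex.Re.
Local Notation Im := complex.Im.

(** Real and imaginary parts of z^n are treated as two real sequences indexed by
a boolean, so that all integrals are real. *)
Definition part (b : bool) (z : R[i]) : R := if b then Re z else Im z.

Definition wave (b : bool) (n : nat) (z : T) : R := part b (circle_val z ^+ n).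

Lemma normc_circle_val_exp (z : T) n : Normc.normc (circle_val z ^+ n) = 1.
Proof.
elim: n => [|n ih]; first by rewrite expr0 Normc.normc1.
by rewrite exprS Normc.normcM ih normc_circle mulr1.
Qed.

Lemma cmeasurable_circle_val_exp n : cmeasurable (fun z : T => circle_val z ^+ n).
Proof.
elim: n => [|n ih].
  by split; under eq_fun do rewrite expr0; exact: measurable_cst.
under eq_fun do rewrite exprS.
by apply: cmeasurableM ih; exact: cmeasurable_circle_val.
Qed.

Lemma measurable_wave b n : measurable_fun setT (wave b n).
Proof. by have [mr mi] := cmeasurable_circle_val_exp n; case: b. Qed.

Lemma wave_le1 b n z : `|wave b n z| <= 1.
Proof.
by rewrite -(normc_circle_val_exp z n); case: b; [exact: norm_Re|exact: norm_Im].
Qed.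

(** The (signed) measure g mu is a Rajchman measure: its Fourier coefficients
vanish at infinity. *)
Definition rajchman (g : T -> R) := forall b, vanishing mu (wave b) g.

(** Rajchman densities are not visibly closed under products. The functions that
act on them by multiplication are, which makes them an algebra. *)
Definition multiplier (h : T -> R) :=
  [/\ measurable_fun setT h, exists M, forall z, `|h z| <= M &
   forall g, rajchman g -> rajchman (fun z => g z * h z)].

Lemma rajchmanD g h : rajchman g -> rajchman h -> rajchman (fun z => g z + h z).
Proof.
move=> rg rh b.
by apply: vanishingD => //; [exact: measurable_wave|exact: wave_le1].
Qed.

Lemma rajchmanZ a g : rajchman g -> rajchman (fun z => a * g z).
Proof.
move=> rg b.
by apply: vanishingZ => //; [exact: measurable_wave|exact: wave_le1].
Qed.

Lemma multiplier_cst a : multiplier (fun=> a).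
Proof.
split; [exact: measurable_cst|by exists (`|a|)|].
by move=> g /(rajchmanZ a); under eq_fun do rewrite mulrC.
Qed.

Lemma multiplierD g h : multiplier g -> multiplier h ->
  multiplier (fun z => g z + h z).
Proof.
move=> [mg [G gG] rg] [mh [H hH] rh]; split; first exact: measurable_funD.
  by exists (G + H) => z; apply: le_trans (ler_normD _ _) _; exact: lerD.
move=> k rk; under eq_fun do rewrite mulrDr.
by apply: rajchmanD; [exact: rg|exact: rh].
Qed.

Lemma multiplierM g h : multiplier g -> multiplier h ->
  multiplier (fun z => g z * h z).
Proof.
move=> [mg [G gG] rg] [mh [H hH] rh]; split; first exact: measurable_funM.
  by exists (G * H) => z; rewrite normrM ler_pM.
by move=> k rk; under eq_fun do rewrite mulrA; exact/rh/rg.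
Qed.

Lemma multiplierZ a g : multiplier g -> multiplier (fun z => a * g z).
Proof. exact/multiplierM/multiplier_cst. Qed.

Lemma multiplierN g : multiplier g -> multiplier (fun z => - g z).
Proof. by move/(multiplierZ (-1)); under eq_fun do rewrite mulN1r. Qed.

Lemma multiplier_cvg (h_ : nat -> T -> R) (h : T -> R) (M : R) :
  (forall k, multiplier (h_ k)) -> (forall k z, `|h_ k z| <= M) ->
  (forall z, h_ k z @[k --> \oo] --> h z) -> multiplier h.
Proof.
move=> mh hM hh; split.
- by apply: (@measurable_fun_cvg _ _ _ _ h_) => [k|z _]; [case: (mh k)|exact: hh].
- exists M => z; have /cvg_norm hz := hh z.
  have /= <- := cvg_lim (@Rhausdorff R) hz; apply: limr_le.
    by apply/cvg_ex; eexists; exact: hz.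
  by apply: nearW => k; exact: hM.
move=> g rg b; have ig := (rg b).1.
apply: (@vanishing_dominated _ _ _ mu (wave b) _ _
  (fun k z => g z * h_ k z) _ (fun z => `|g z| * M)).
- exact: measurable_wave.
- exact: wave_le1.
- by move=> k; case: (mh k) => _ _; exact.
- under [X in EFin \o X]eq_fun do rewrite mulrC.
  exact: (integrableZ M (integrable_abse ig)).
- by move=> k z; rewrite normrM ler_wpM2l.
- by move=> z; apply: cvgM; [exact: cvg_cst|exact: hh].
Qed.

Lemma circle_sq (z : T) :
  (Re (circle_val z)) ^+ 2 + (Im (circle_val z)) ^+ 2 = 1.
Proof.
have := normc_circle z; case: (circle_val z) => a b /= ab.
have := sqr_sqrtr (addr_ge0 (sqr_ge0 a) (sqr_ge0 b)).
by rewrite ab expr1n.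
Qed.

Lemma waveS b n z : wave b n.+1 z =
  Re (circle_val z) * wave b n z +
  (if b then - Im (circle_val z) else Im (circle_val z)) * wave (~~ b) n z.
Proof.
by case: b; rewrite /wave /part /= exprS ?Defs.ReM ?Defs.ImM ?mulNr// addrC.
Qed.

(** On the circle 2 Re z = z + z^-1 and 2 Im z = (z - z^-1) / i, so multiplying by
Re z or Im z shifts the exponent by one in both directions. *)
Lemma waveRe b n z : Re (circle_val z) * wave b n.+1 z =
  2^-1 * wave b n.+2 z + 2^-1 * wave b n z.
Proof.
have cs := circle_sq z; rewrite !waveS.
have h := congr1 ( *%R^~ (wave b n z)) cs.
by case: b h => /= h; lra.
Qed.

Lemma waveIm b n z : Im (circle_val z) * wave b n.+1 z =
  (if b then 2^-1 else - 2^-1) * wave (~~ b) n.+2 z +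
  (if b then - 2^-1 else 2^-1) * wave (~~ b) n z.
Proof.
have cs := circle_sq z; rewrite !waveS.
have h := congr1 ( *%R^~ (wave (~~ b) n z)) cs.
by case: b h => /= h; lra.
Qed.

(** A function that shifts the exponents maps Fourier coefficients to
combinations of neighbouring ones, which preserves vanishing at infinity. *)
Lemma multiplier_shift (h : T -> R) (s : bool -> bool) (a c : bool -> R) :
  measurable_fun setT h -> (forall z, `|h z| <= 1) ->
  (forall b n z, h z * wave b n.+1 z =
    a b * wave (s b) n.+2 z + c b * wave (s b) n z) ->
  multiplier h.
Proof.
move=> mh h1 hw; split=> //; first by exists 1.
move=> g rg b; have ig := (rg b).1; have [_ v] := rg (s b).
have iw b' n := integrable_wave (measurable_wave b') (wave_le1 b') n ig.
split; first exact: (integrableM_bounded ig mh h1).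
suff sh : (fun n => \int[mu]_z (g z * h z * wave b n.+1 z)) @ \oo --> (0 : R).
  by rewrite -cvg_shiftS; exact: sh.
have -> : (fun n => \int[mu]_z (g z * h z * wave b n.+1 z)) =
  (fun n => a b * \int[mu]_z (g z * wave (s b) n.+2 z) +
            c b * \int[mu]_z (g z * wave (s b) n z)).
  apply/funext => n; rewrite -!RintegralZl// -RintegralD//; try exact: integrableZ.
  by apply: eq_Rintegral => z _; rewrite -mulrA hw; ring.
have -> : 0 = a b * 0 + c b * 0 by rewrite !mulr0 addr0.
apply: cvgD; apply: cvgM; try exact: cvg_cst; last exact: v.
by have := v; rewrite -cvg_shiftS -cvg_shiftS.
Qed.

Lemma multiplierRe : multiplier (fun z => Re (circle_val z)).
Proof.
have [mr _] := @cmeasurable_circle_val R.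
apply: (multiplier_shift mr _ waveRe) => z.
by rewrite -(normc_circle z) norm_Re.
Qed.

Lemma multiplierIm : multiplier (fun z => Im (circle_val z)).
Proof.
have [_ mi] := @cmeasurable_circle_val R.
apply: (multiplier_shift mi _ waveIm) => z.
by rewrite -(normc_circle z) norm_Im.
Qed.

(** The Newton-Schulz iteration for the sign function: its iterates are
polynomials, bounded by 1 on [-1, 1], and converge to the sign there. The
convergence at 0 is exact, so that no boundary case remains. *)
Definition sg_step (s : R) := s * (3 - s ^+ 2) / 2.

Lemma sg_step_bound s : `|s| <= 1 -> `|sg_step s| <= 1.
Proof.
rewrite !ler_norml /sg_step => /andP[s1 s2].
have h1 : 0 <= (1 - s) ^+ 2 * (2 + s) by rewrite mulr_ge0 ?sqr_ge0//; lra.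
have h2 : 0 <= (1 + s) ^+ 2 * (2 - s) by rewrite mulr_ge0 ?sqr_ge0//; lra.
by apply/andP; split; lra.
Qed.

Lemma iter_sg_bound s n : `|s| <= 1 -> `|iter n sg_step s| <= 1.
Proof. by move=> s1; elim: n => //= n; exact: sg_step_bound. Qed.

Lemma iter_sgN s n : iter n sg_step (- s) = - iter n sg_step s.
Proof. by elim: n => //= n ->; rewrite /sg_step sqrrN !mulNr. Qed.

(** With t the n-th iterate, 1 - sg_step t = (1 - t) (2 - t - t^2) / 2, and the
last factor is at most 1 - s/2 since the iterates increase from s. *)
Lemma iter_sg_gt0 s n : 0 < s <= 1 ->
  s <= iter n sg_step s <= 1 /\ 1 - iter n sg_step s <= (1 - s / 2) ^+ n.
Proof.
move=> /andP[s0 s1]; elim: n => [|n] /=.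
  by rewrite lexx s1 expr0; split=> //; lra.
set t := iter n _ s => -[/andP[st t1] th].
have t1' : 1 - sg_step t = (1 - t) * ((2 - t - t ^+ 2) / 2).
  by rewrite /sg_step; lra.
have t2 : t ^+ 2 <= t by rewrite expr2 ler_piMr//; lra.
split.
  have : 0 <= 1 - sg_step t by rewrite t1' mulr_ge0//; lra.
  have : 0 <= t * (1 - t ^+ 2) by rewrite mulr_ge0//; lra.
  by rewrite /sg_step => h1 h2; apply/andP; split; lra.
by rewrite t1' [leRHS]exprSr; apply: ler_pM => //; have := sqr_ge0 t; lra.
Qed.

Lemma cvg_iter_sg s : `|s| <= 1 -> iter n sg_step s @[n --> \oo] --> Num.sg s.
Proof.
have pos t : 0 < t <= 1 -> iter n sg_step t @[n --> \oo] --> (1 : R).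
  move=> t01; have /andP[t0 t1] := t01.
  have v : (1 - (1 - t / 2) ^+ n) @[n --> \oo] --> (1 : R).
    rewrite -[X in _ --> X]subr0; apply: cvgB; first exact: cvg_cst.
    by apply: cvg_expr; rewrite ger0_norm; lra.
  apply: (@squeeze_cvgr _ _ _ _ (fun n => 1 - (1 - t / 2) ^+ n) (fun=> 1)) => //;
    last exact: cvg_cst.
  apply: nearW => n.
  by have [/andP[_ ->] h] := iter_sg_gt0 n t01; rewrite andbT; lra.
move=> s1; have [s0|s0|->] := ltrgt0P s.
- rewrite gtr0_sg//; apply: pos; rewrite s0 /=.
  exact: le_trans (ler_norm _) s1.
- rewrite ltr0_sg//.
  have -> : (fun n => iter n sg_step s) = (fun n => - iter n sg_step (- s)).
    by apply/funext => n; rewrite iter_sgN opprK.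
  by apply: cvgN; apply: pos; rewrite oppr_gt0 s0 /= -(ltr0_norm s0).
- rewrite sgr0; have -> : (fun n => iter n sg_step 0) = cst 0.
    by apply/funext; elim=> //= n ->; rewrite /sg_step !mul0r.
  exact: cvg_cst.
Qed.

(** After rescaling h into [-1, 1], its sign is a bounded limit of polynomials
in h. *)
Lemma multiplier_sg (h : T -> R) :
  multiplier h -> multiplier (fun z => Num.sg (h z)).
Proof.
move=> mh; have [_ [M hM] _] := mh.
pose N := `|M| + 1; have N0 : 0 < N by rewrite ltr_wpDl.
have hN z : `|N^-1 * h z| <= 1.
  rewrite normrM gtr0_norm ?invr_gt0// ler_pdivrMl// mulr1.
  by apply: le_trans (hM z) _; rewrite (le_trans (ler_norm M))// lerDl.
have -> : (fun z => Num.sg (h z)) = (fun z => Num.sg (N^-1 * h z)).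
  by apply/funext => z; rewrite sgrM (@gtr0_sg _ N^-1) ?invr_gt0// mul1r.
apply: (@multiplier_cvg (fun k z => iter k sg_step (N^-1 * h z)) _ 1).
- elim=> [|k ih] /=; first exact: multiplierZ.
  apply: multiplierM; last exact: multiplier_cst.
  apply: multiplierM => //; apply: multiplierD; first exact: multiplier_cst.
  by apply: multiplierN; exact: multiplierM.
- by move=> k z; exact: iter_sg_bound.
- by move=> z; exact: cvg_iter_sg.
Qed.

Lemma multiplier_gt (h : T -> R) a : multiplier h ->
  multiplier \1_[set z | a < h z].
Proof.
move=> mh.
have /multiplier_sg msg : multiplier (fun z => h z - a).
  exact: multiplierD mh (multiplier_cst _).
have -> : \1_[set z | a < h z] =
  (fun z => 2^-1 * (Num.sg (h z - a) + Num.sg (h z - a) * Num.sg (h z - a))).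
  apply/funext => z; rewrite indicE.
  have -> : (z \in [set z | a < h z]) = (0 < h z - a).
    by rewrite subr_gt0; apply/idP/idP; rewrite inE.
  by case: sgrP => _ /=; lra.
by apply: multiplierZ; apply: multiplierD => //; exact: multiplierM.
Qed.

Definition multiplier_set (A : set T) := multiplier \1_A.

(** Complements and intersections come from the algebra structure of the
multipliers, countable unions from their stability under bounded limits. *)
Lemma sigma_algebra_multiplier_set : sigma_algebra setT multiplier_set.
Proof.
have msC A : multiplier_set A -> multiplier_set (~` A).
  rewrite /multiplier_set => mA.
  have -> : \1_(~` A) = (fun z => 1 - \1_A z) :> (T -> R).
    by apply/funext => z; rewrite !indicE in_setC; case: (z \in A) => /=; lra.
  exact: multiplierD (multiplier_cst 1) (multiplierN mA).
have msU A B : multiplier_set A -> multiplier_set B -> multiplier_set (A `|` B).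
  move=> /msC mA /msC mB; rewrite -(setCK (A `|` B)) setCU.
  apply: msC; rewrite /multiplier_set indicI; exact: multiplierM.
split.
- by rewrite /multiplier_set indic0; exact: multiplier_cst.
- by move=> A; rewrite setTD; exact: msC.
move=> A mA; pose B n := \big[setU/set0]_(i < n) A i.
have mB n : multiplier_set (B n).
  rewrite /B; elim: n => [|n ih].
    by rewrite big_ord0 /multiplier_set indic0; exact: multiplier_cst.
  by rewrite big_ord_recr; exact: msU.
apply: (@multiplier_cvg (fun n => \1_(B n)) _ 1) => //.
  by move=> n z; rewrite indicE; case: (_ \in _); rewrite ?normr1 ?normr0.
move=> z; rewrite indicE; have [[i _ Az]|nA] := pselect ((\bigcup_i A i) z).
  rewrite mem_set; last by exists i.
  apply: cvg_near_cst; exists i.+1 => // n /= ni.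
  by rewrite indicE mem_set// /B -bigcup_mkord; exists i.
rewrite memNset//; apply: cvg_near_cst; apply: nearW => n.
rewrite indicE memNset// /B -bigcup_mkord => -[i _ Az]; apply: nA; by exists i.
Qed.

Let box (a b c e : R) : set T := [set z |
  (a < Re (circle_val z) < b) && (c < Im (circle_val z) < e)].

Lemma multiplier_set_box a b c e : multiplier_set (box a b c e).
Proof.
have -> : box a b c e =
    [set z | a < Re (circle_val z)] `&` [set z | - b < - Re (circle_val z)] `&`
    [set z | c < Im (circle_val z)] `&` [set z | - e < - Im (circle_val z)].
  apply/seteqP; split=> z; rewrite /box /= !ltrN2.
    by move=> /andP[/andP[-> ->] /andP[-> ->]].
  by move=> [[[-> ->] ->] ->].
rewrite /multiplier_set !indicI; repeat apply: multiplierM.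
- exact: multiplier_gt multiplierRe.
- exact/multiplier_gt/multiplierN/multiplierRe.
- exact: multiplier_gt multiplierIm.
- exact/multiplier_gt/multiplierN/multiplierIm.
Qed.

(** The Borel sets are generated by the traces of the open sets of the plane,
and every open set of the plane is a countable union of rational boxes. *)
Lemma multiplier_set_measurable (A : set T) : measurable A -> multiplier_set A.
Proof.
have sG := sigma_algebra_multiplier_set.
pose G : set (set T) := multiplier_set.
have GE := measurable_g_measurableTypeE sG.
apply: smallest_sub => // U [V oV <-]; set U' := _ @^-1` _.
pose B a b c e := if `[< box a b c e `<=` U' >] then box a b c e else set0.
have -> : U' = \bigcup_(a : rat) \bigcup_(b : rat) \bigcup_(c : rat)
    \bigcup_(e : rat) B (ratr a) (ratr b) (ratr c) (ratr e).
  apply/seteqP; split=> z; last first.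
    move=> [a _ [b _ [c _ [e _]]]]; rewrite /B.
    by case: ifPn => // /asboolP; apply.
  move=> Uz; have := open_nbhs_nbhs (conj oV Uz).
  move=> /nbhs_ballP[r /= r0 rV].
  have rR : r = (Re r)%:C%C.
    by move: r0; rewrite ltcE; case: r {rV} => r r' /= /andP[/eqP ->].
  pose s := Re r; have s0 : 0 < s by move: r0; rewrite rR ltcR.
  set x := Re (circle_val z); set y := Im (circle_val z).
  have [a] := @rat_in_itvoo R (x - s / 2) x ltac:(lra).
  rewrite in_itv /= => /andP[a1 a2].
  have [b] := @rat_in_itvoo R x (x + s / 2) ltac:(lra).
  rewrite in_itv /= => /andP[b1 b2].
  have [c] := @rat_in_itvoo R (y - s / 2) y ltac:(lra).
  rewrite in_itv /= => /andP[c1 c2].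
  have [e] := @rat_in_itvoo R y (y + s / 2) ltac:(lra).
  rewrite in_itv /= => /andP[e1 e2].
  exists a => //; exists b => //; exists c => //; exists e => //.
  rewrite /B ifT; first by rewrite /box /= a2 b1 c2 e1.
  apply/asboolP => w /= /andP[/andP[aw bw] /andP[cw ew]].
  apply: rV; rewrite -ball_normE /= rR.
  rewrite -[`|_|]/((Normc.normc _)%:C)%C ltcR.
  apply: le_lt_trans (normc_le _) _.
  have -> : Re (set_val z - set_val w) = x - Re (circle_val w).
    by rewrite /x /circle_val; case: (set_val z) => ? ?; case: (set_val w).
  have -> : Im (set_val z - set_val w) = y - Im (circle_val w).
    by rewrite /y /circle_val; case: (set_val z) => ? ?; case: (set_val w).
  by rewrite -/s (splitr s); apply: ltrD; rewrite ltr_norml; apply/andP; split; lra.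
have mB a b c e : multiplier_set (B a b c e).
  by rewrite /B; case: ifP => _; [exact: multiplier_set_box|case: sG].
set W := \bigcup_a _; suff : G.-sigma.-measurable W by rewrite GE.
rewrite /W; do 4 (apply: bigcupT_measurable_rat => ?).
by rewrite GE; exact: mB.
Qed.

(** Any integrable g is an L1 limit of simple functions, and these are
combinations of the constant 1 multiplied by indicators. *)
Theorem rajchman_integrable (g : T -> R) : rajchman (cst 1) ->
  mu.-integrable setT (EFin \o g) -> rajchman g.
Proof.
move=> r1 ig.
have rsum (I : Type) (s : seq I) (F : I -> T -> R) : (forall i, rajchman (F i)) ->
    rajchman (fun z => \sum_(i <- s) F i z).
  move=> rF; elim: s => [|i s ih].
    have -> : (fun z => \sum_(i <- [::]) F i z) = (fun z => 0 * cst 1 z).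
      by apply/funext => z; rewrite big_nil mul0r.
    exact: rajchmanZ.
  have -> : (fun z => \sum_(j <- i :: s) F j z) = (fun z => F i z + \sum_(j <- s) F j z).
    by apply/funext => z; rewrite big_cons.
  exact: rajchmanD.
have [g_ [_ _ gg]] := approximation_sfun_integrable measurableT ig.
have rg_ n : rajchman (g_ n).
  have -> : g_ n = (fun z => \sum_(y <- finmap.enum_fset (fset_set (range (g_ n))))
      y * \1_(g_ n @^-1` [set y]) z) :> (T -> R).
    by apply/funext => z; rewrite fimfunE fsbig_finite.
  apply: (rsum _ _ (fun y z => y * \1_(g_ n @^-1` [set y]) z)) => y.
  apply: rajchmanZ.
  have [_ _ /(_ _ r1)] :=
    multiplier_set_measurable (measurable_funPTI (g_ n) (measurable_set1 y)).
  by under eq_fun do rewrite mul1r.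
move=> b; apply: (vanishing_L1 (measurable_wave b) (wave_le1 b) (fun k => rg_ k b) ig).
apply: cvg_trans gg; apply: near_eq_cvg; apply: nearW => n.
by apply: eq_integral => z _ /=; rewrite distrC.
Qed.

End Rajchman.

(** * The multiplication operator *)

Section Multiplication.
Local Open Scope complex_scope.
Context (R : realType) (mu : {finite_measure set (borel_circle R) -> \bar R}).
Local Notation normc := (@Normc.normc R).
Local Notation T := (borel_circle R).
Local Notation Re := complex.Re.
Local Notation Im := complex.Im.

Lemma iter_mulzE n (F : L2 mu) :
  {ae mu, forall z, repr (iter n (mulz mu) F) z = circle_val z ^+ n * repr F z}.
Proof.
elim: n => [|n ih]; first by apply: aeW => z; rewrite expr0 mul1r.
apply: filterS2 ih (repr_L2_class (mulz_fun (repr (iter n (mulz mu) F)))) => z.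
by rewrite exprS -mulrA => <- /= ->.
Qed.

Lemma rnorm_iter_mulz n (F : L2 mu) : rnorm (iter n (mulz mu) F) = rnorm F.
Proof. by rewrite /rnorm; congr Re; elim: n => //= n <-; exact: mulz_isometry. Qed.

Lemma rajchman_cst1 : vanishing_fourier mu -> rajchman mu (cst 1).
Proof.
move=> hmu b; split; first exact: finite_measure_integrable_cst.
apply/cvgr0Pnorm_lt => e e0; have [N hN] := hmu e e0.
exists N => // n /= Nn; apply: le_lt_trans (hN n Nn).
under eq_Rintegral do rewrite mul1r.
by case: b; [exact: norm_Re (fourier_coef mu n)|exact: norm_Im (fourier_coef mu n)].
Qed.

(** <M^n F, G> is the n-th Fourier coefficient of the measure with the integrable
density F conj(G). *)
Lemma inner_iter_mulz_cvg0 (F G : L2 mu) : vanishing_fourier mu ->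
  forall e : R, 0 < e -> exists N, forall n, (N <= n)%N ->
    normc (inner (iter n (mulz mu) F) G) < e.
Proof.
move=> /rajchman_cst1 r1 e e0.
pose h := pairing (repr F) (repr G).
have [ir ii] : cintegrable mu h := pairing_cintegrable _ _.
have rr := rajchman_integrable r1 ir; have ri := rajchman_integrable r1 ii.
have key b (g : T -> R) : rajchman mu g ->
    exists N, forall n, (N <= n)%N -> `|\int[mu]_z (g z * wave b n z)| < e / 4.
  move=> /(_ b) [_ /cvgr0Pnorm_lt /(_ (e / 4))].
  by case; [rewrite divr_gt0|move=> N _ hN; exists N => n; exact: hN].
have [N1 h1] := key true _ rr; have [N2 h2] := key false _ rr.
have [N3 h3] := key true _ ri; have [N4 h4] := key false _ ri.
exists (maxn (maxn N1 N2) (maxn N3 N4)) => n.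
rewrite !geq_max => /andP[/andP[/h1 {}h1 /h2 {}h2] /andP[/h3 {}h3 /h4 {}h4]].
have -> : inner (iter n (mulz mu) F) G =
    cintegral mu (fun z => circle_val z ^+ n * h z).
  apply: eq_ae_cintegral; first exact: pairing_cmeasurable.
    by apply: cmeasurableM; [exact: cmeasurable_circle_val_exp|exact: pairing_cmeasurable].
  apply: filterS (iter_mulzE n F) => z.
  by rewrite /h /pairing => ->; rewrite mulrA.
have iw b g : mu.-integrable setT (EFin \o g) ->
    mu.-integrable setT (EFin \o (fun z => g z * wave b n z)).
  by move=> ig; exact: (integrable_wave (@measurable_wave _ b) (@wave_le1 _ b)).
apply: le_lt_trans (normc_le _) _; rewrite /cintegral /=.
have -> : \int[mu]_z Re (circle_val z ^+ n * h z) =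
    \int[mu]_z (Re (h z) * wave true n z) -
    \int[mu]_z (Im (h z) * wave false n z).
  rewrite -RintegralB//; try exact: iw.
  by apply: eq_Rintegral => z _; rewrite Defs.ReM /wave /part; ring.
have -> : \int[mu]_z Im (circle_val z ^+ n * h z) =
    \int[mu]_z (Im (h z) * wave true n z) +
    \int[mu]_z (Re (h z) * wave false n z).
  rewrite -RintegralD//; try exact: iw.
  by apply: eq_Rintegral => z _; rewrite Defs.ImM /wave /part; ring.
apply: le_lt_trans (lerD (ler_normB _ _) (ler_normD _ _)) _.
have -> : e = e / 4 + e / 4 + (e / 4 + e / 4) by field.
exact: ltrD (ltrD h1 h4) (ltrD h3 h2).
Qed.

Lemma inner_cvg (u : nat -> L2 mu) (l G : L2 mu) :
  u @ \oo --> (l : weak_space (L2 mu)) ->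
  forall e : R, 0 < e -> \forall n \near \oo, normc (inner (u n) G - inner l G) < e.
Proof.
move=> /cvg_weak_space /(_ (inner_with G) (@inner_continuous _ _ _ _ G)).
move=> /cvgrPdist_lt h e e0; have := h e%:C.
rewrite ltcR => /(_ e0); apply: filterS => n /=.
by rewrite distrC -[`|_|]/((normc _)%:C) ltcR.
Qed.

Lemma innerDZ (a : R[i]) (F G H : L2 mu) :
  inner (a *: F + G) H = a * inner F H + inner G H.
Proof. exact: inner_linear. Qed.

Lemma inner0 (H : L2 mu) : inner 0 H = 0.
Proof. exact: (linear0 (inner_with H)). Qed.

Lemma innerZ (a : R[i]) (F H : L2 mu) : inner (a *: F) H = a * inner F H.
Proof. exact: (linearZ_LR (inner_with H)). Qed.

(** Lines are weakly closed: a component w of l orthogonal to g pairs to 0 with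
the whole line, but not with l. *)
Lemma weak_lim_line (u : nat -> L2 mu) (l g : L2 mu) :
  u @ \oo --> (l : weak_space (L2 mu)) ->
  (forall c, l <> c *: g) ->
  \forall k \near \oo, forall c, u k <> c *: g.
Proof.
move=> ul lg.
(* For g = 0 the division by 0 gives d = 0 and w = l. *)
pose d := (- inner g l / inner g g)^*; pose w := d *: g + l.
have gw : inner g w = 0.
  have -> : inner g w = (- inner g l / inner g g) * inner g g + inner g l.
    rewrite /w inner_conjD inner_conjZ; congr (_ * _ + _); exact: conjcK.
  have [g0|gn0] := eqVneq g 0; first by rewrite g0 !inner0 mulr0 addr0.
  rewrite divfK ?addNr//; apply: contra_neq gn0; rewrite inner_diag.
  move=> /(congr1 (@Re R)) /= /eqP; rewrite sqrf_eq0 => /eqP.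
  exact: rnorm_eq0.
have lw : inner w w = inner l w by rewrite {1}/w innerDZ gw mulr0 add0r.
have lw0 : 0 < normc (inner l w).
  rewrite lt0r normc_ge0 andbT; apply/eqP => /Normc.eq0_normc.
  rewrite -lw inner_diag => /(congr1 (@Re R)) /= /eqP.
  rewrite sqrf_eq0 => /eqP /rnorm_eq0 w0.
  by apply: (lg (- d)); apply/eqP; rewrite scaleNr -addr_eq0 addrC -/w w0.
apply: filterS (inner_cvg w ul lw0) => k hk c uk; move: hk.
by rewrite uk innerZ gw mulr0 sub0r normcN ltxx.
Qed.

(** If l were outside the orbit, n_k would tend to infinity, because l avoids
each of the lines; then a_k M^(n_k) f would pair to 0 with l in the limit. *)
Lemma weak_lim_proj_orbit (u : nat -> L2 mu) (f l : L2 mu)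
    (n : nat -> nat) (a : nat -> R[i]) : vanishing_fourier mu ->
  u @ \oo --> (l : weak_space (L2 mu)) ->
  (forall k, u k = a k *: iter (n k) (mulz mu) f) ->
  proj_orbit (mulz mu) f l.
Proof.
move=> hmu ul ua; apply: contrapT => lout.
have nl0 : 0 < rnorm l.
  rewrite lt0r rnorm_ge0 andbT; apply/eqP => /rnorm_eq0 l0.
  by apply: lout; exists 0%N, 0; rewrite scale0r.
(* Each line through an iterate of f is visited finitely often. *)
have escape m : \forall k \near \oo, (m <= n k)%N.
  elim: m => [|m ih]; first exact: nearW.
  have hm : forall c, l <> c *: iter m (mulz mu) f.
    by move=> c lc; apply: lout; exists m, c.
  apply: filterS2 ih (weak_lim_line ul hm) => k mk nk.
  rewrite ltn_neqAle mk andbT; apply/eqP => mnk.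
  by apply: (nk (a k)); rewrite mnk.
have [M hM] := weakly_convergent_bounded ul.
have normua k : rnorm (u k) = normc (a k) * rnorm f.
  by rewrite ua rnormZ rnorm_iter_mulz.
have [f0|fn0] := eqVneq (rnorm f) 0.
  have lc c : l <> c *: 0.
    by rewrite scaler0 => l0; move: nl0; rewrite l0 /rnorm normr0 ltxx.
  have [N _ /(_ N (leqnn N)) hN] := weak_lim_line ul lc.
  by apply: (hN 0); rewrite scaler0; apply: rnorm_eq0; rewrite normua f0 mulr0.
have fgt0 : 0 < rnorm f by rewrite lt0r fn0 rnorm_ge0.
pose B := M / rnorm f.
have aB k : normc (a k) <= B by rewrite ler_pdivlMr// -normua.
have B0 : 0 <= B by apply: le_trans (aB 0%N); exact: normc_ge0.
pose L := rnorm l ^+ 2 / 2; have L0 : 0 < L by rewrite divr_gt0// exprn_gt0.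
have LB0 : 0 < L / (B + 1) by rewrite divr_gt0// ltr_wpDl.
have [N hN] := inner_iter_mulz_cvg0 f l hmu LB0.
have [k [/hN hk Il]] := filter_ex (filterI (escape N) (inner_cvg l ul L0)).
have Ie : normc (inner (u k) l) <= L.
  rewrite ua innerZ Normc.normcM.
  apply: (@le_trans _ _ (B * (L / (B + 1)))).
    by rewrite ler_pM ?normc_ge0 ?aB//; exact: ltW.
  by rewrite mulrA ler_pdivrMr ?ltr_wpDl// mulrC ler_wpM2l ?lerDl//; exact: ltW.
have := le_normcD (inner (u k) l) (- (inner (u k) l - inner l l)).
rewrite normcN opprB addrC subrK {1}inner_diag normc_real ger0_norm ?sqr_ge0//.
by rewrite leNgt => /negP; apply; rewrite [ltRHS](splitr) ler_ltD.
Qed.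

Theorem proj_orbit_weakly_seq_closed (f : L2 mu) : vanishing_fourier mu ->
  weakly_seq_closed (proj_orbit (mulz mu) f).
Proof.
move=> hmu u l /choice[n /choice[a ua]] ul.
exact: (weak_lim_proj_orbit hmu ul ua).
Qed.

Lemma bounded_square_integrable (h : T -> R[i]) (M : R) :
  cmeasurable h -> (forall z, normc (h z) <= M) -> square_integrable mu h.
Proof.
move=> mh hM; split=> //.
have : cst M \in Lfun mu 2%:E by exact: Lfun_cst.
rewrite inE => /andP[_]; rewrite inE => /= ; rewrite /finite_norm.
apply: le_lt_trans; apply: le_Lnorm2 => //; first exact: cmeasurable_normc.
by move=> z /=; rewrite ger0_norm ?normc_ge0// (le_trans (hM z))// ler_norm.
Qed.

Lemma ae_exists (P : T -> Prop) : mu setT != 0%E -> {ae mu, forall z, P z} ->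
  exists z, P z.
Proof.
move=> mu0 [A [mA A0 PA]]; apply: contrapT => nP.
move/eqP: mu0; apply; apply/eqP; rewrite -measure_le0 -A0.
apply: le_measure; rewrite ?inE//.
by move=> z _; apply: PA => /= Pz; apply: nP; exists z.
Qed.

(** Multiplication by z does not change the modulus. *)
Lemma proj_orbit_normc (f : L2 mu) (h : sqint_fun mu) :
  proj_orbit (mulz mu) f (L2_class h) ->
  exists c : R, {ae mu, forall z, normc (h z) = c * normc (repr f z)}.
Proof.
move=> [n [a ha]]; exists (normc a).
have hE : {ae mu, forall z, h z = a * repr (iter n (mulz mu) f) z}.
  have : L2_class h = L2_class (a *: repr (iter n (mulz mu) f)).
    by rewrite L2_classZ L2_classK.
  by move=> /L2_class_eqP; apply: filterS => z ->; rewrite sqint_valZ.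
apply: filterS2 hE (iter_mulzE n f) => z -> ->.
by rewrite !Normc.normcM normc_circle_val_exp mul1r.
Qed.

(** The functions 2, 2 + Re z and 2 + Im z are equal to their moduli, hence
proportional to each other if all of them are in one projective orbit. *)
Lemma ae_constant_circle_val (f : L2 mu) : mu setT != 0%E ->
  (forall F, proj_orbit (mulz mu) f F) ->
  exists w : T, {ae mu, forall z, circle_val z = circle_val w}.
Proof.
move=> mu0 full.
have bnd (p : T -> R) : measurable_fun setT p -> (forall z, `|p z| <= 1) ->
  exists c, {ae mu, forall z, 2 + p z = c * normc (repr f z)}.
  move=> mp p1; pose h z := (2 + p z)%:C.
  have sh : h \in sqint mu.
    rewrite inE; apply: (@bounded_square_integrable _ 3).
      by split => /=; [exact: measurable_funD|exact: measurable_cst].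
    move=> z; have := p1 z; rewrite normc_real ler_norml => /andP[? ?].
    by rewrite ger0_norm; lra.
  have [c hc] := proj_orbit_normc (full (L2_class (SqintFun sh))).
  exists c; apply: filterS hc => z <-; rewrite -[sqint_val _ z]/(h z) normc_real.
  by have := p1 z; rewrite ler_norml => /andP[? ?]; rewrite ger0_norm; lra.
have [mr mi] := @cmeasurable_circle_val R.
have [c0 h0] := bnd (cst 0) (measurable_cst _) ltac:(by move=> z; rewrite normr0).
have [c1 h1] := bnd _ mr ltac:(by move=> z; rewrite -(normc_circle z) norm_Re).
have [c2 h2] := bnd _ mi ltac:(by move=> z; rewrite -(normc_circle z) norm_Im).
have h012 : {ae mu, forall z, normc (repr f z) = 2 / c0 /\
    circle_val z = (c1 * (2 / c0) - 2) +i* (c2 * (2 / c0) - 2)}.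
  apply: filterS3 h0 h1 h2 => z /= e0 e1 e2.
  have c0n : c0 != 0 by apply/eqP => c00; move: e0; rewrite c00; lra.
  have fE : normc (repr f z) = 2 / c0 by rewrite -(mulKf c0n (normc _)) -e0; field.
  split=> //; move: e1 e2; rewrite fE; case: (circle_val z) => x y /= <- <-.
  by congr (_ +i* _); ring.
have [w [_ hw]] := ae_exists mu0 h012.
by exists w; apply: filterS h012 => z [_ ->]; rewrite hw.
Qed.

Theorem not_weakly_seq_supercyclic_mulz : vanishing_fourier mu -> mu setT != 0%E ->
  ~ weakly_seq_supercyclic (mulz mu).
Proof.
move=> hmu mu0 [f dense].
have full F : proj_orbit (mulz mu) f F.
  have : seq_closure (proj_orbit (mulz mu) f : set (weak_space (L2 mu))) F.
    by rewrite /weakly_seq_dense /seq_dense in dense; rewrite dense.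
  by apply; split=> //; exact: proj_orbit_weakly_seq_closed.
have [w hw] := ae_constant_circle_val mu0 full.
have mpos : 0 < fine (mu setT).
  by rewrite fine_gt0// lt0e mu0 measure_ge0 /= ltey_eq fin_num_measure.
(* With z = w almost everywhere, the N-th coefficient w^N mu(T) has modulus
   mu(T). *)
have [N /(_ N%:Z (leqnn N))] := hmu _ mpos.
have -> : fourier_coef mu N%:Z = circle_val w ^+ N * (fine (mu setT))%:C.
  transitivity (cintegral mu (fun z => circle_val w ^+ N)).
    apply: eq_ae_cintegral.
    - exact: cmeasurable_circle_val_exp.
    - by split; exact: measurable_cst.
    by apply: filterS hw => z ->.
  rewrite /cintegral !Rintegral_cst//; case: (_ ^+ N) => a b.
  by apply/eqP; rewrite eq_complex /= !mulr0 subr0 add0r !eqxx.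
rewrite Normc.normcM normc_circle_val_exp mul1r normc_real.
by rewrite ger0_norm ?ltxx// ltW.
Qed.

End Multiplication.

Unset Implicit Arguments.

Theorem proposition1p1 (R : realType)
    (mu : {finite_measure set (borel_circle R) -> \bar R})
    (hmu : vanishing_fourier mu) :
  (forall f : L2 mu, weakly_seq_closed (proj_orbit (mulz mu) f)) /\
  (mu setT != 0%E -> ~ weakly_seq_supercyclic (mulz mu)).
Proof.
split; first by move=> f; exact: proj_orbit_weakly_seq_closed.
exact: not_weakly_seq_supercyclic_mulz.
Qed.
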